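(* Fix a cost parameter $c\in[0,1]$ and a linear disparity measure $\mathrm{Dis}$ with weighting function $w_{\mathrm{Dis}}$. Suppose that for $a\in\{0,1\}$ both $\eta_a(X)$ and $w_{\mathrm{Dis}}(X,a)$ have probability density functions when $X\sim\mathbb P_{X\mid A=a}$, the boundary sets $\{x:\eta_a(x)=c+t\,w_{\mathrm{Dis}}(x,a)\}$, $t\in\mathbb R$, being of $\mathbb P_{X\mid A=a}$-measure zero. For $t\in\mathbb R$ let $$D_{\mathrm{Dis},c}(t)=\sum_{a\in\{0,1\}}p_a\int_{\mathcal X}w_{\mathrm{Dis}}(x,a)\,I\big(\eta_a(x)>c+t\,w_{\mathrm{Dis}}(x,a)\big)\,d\mathbb P_{X\mid A=a}(x),$$ and for $\delta\ge0$ let $t_{\mathrm{Dis},c}(\delta)=\operatorname{argmin}_t\{|t|:|D_{\mathrm{Dis},c}(t)|\le\delta\}$. Then, for any $\delta>0$, there exists a $\delta$-fair Bayes-optimal classifier $f^\star_{\mathrm{Dis},c}$ under the cost-sensitive risk $R_c$ such that for all $x,a$, $$f^\star_{\mathrm{Dis},c}(x,a)=I\big(\eta_a(x)>c+t_{\mathrm{Dis},c}(\delta)\,w_{\mathrm{Dis}}(x,a)\big).$$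
   Context: Let $(X,A,Y)\sim\mathbb P$ be a random triple with values in $\mathcal X\times\{0,1\}\times\{0,1\}$, $p_a=\mathbb P(A=a)>0$, $\eta_a(x)=\mathbb P(Y=1\mid A=a,X=x)$, and $\mathbb P_{X\mid A=a}$ the conditional law of $X$ given $A=a$. $I(\cdot)$ is the indicator function. A (randomized) classifier is a measurable $f:\mathcal X\times\{0,1\}\to[0,1]$; $\mathcal F$ is the set of all of them. Its prediction satisfies $\widehat Y_f\mid X=x,A=a\sim\mathrm{Bernoulli}(f(x,a))$, conditionally independent of $Y$ given $(X,A)$. The cost-sensitive risk is $R_c(f)=c\,\mathbb P(\widehat Y_f=1,Y=0)+(1-c)\,\mathbb P(\widehat Y_f=0,Y=1)$. A disparity measure $\mathrm{Dis}:\mathcal F\to[-1,1]$ is linear if there is a weighting function $w_{\mathrm{Dis}}:\mathcal X\times\{0,1\}\to\mathbb R$ (depending on $\mathbb P$) such that for all $f\in\mathcal F$, $\mathrm{Dis}(f)=\int f(x,a)\,w_{\mathrm{Dis}}(x,a)\,d\mathbb P_{X,A}(x,a)$. A $\delta$-fair Bayes-optimal classifier under the cost-sensitive risk is any element of $\operatorname{argmin}\{R_c(f):f\in\mathcal F,\ |\mathrm{Dis}(f)|\le\delta\}$. *)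

(* Defs.v *)
From HB Require Import structures.
From mathcomp Require Import all_boot all_order all_algebra.
From mathcomp Require Import all_classical all_reals all_analysis.
From mathcomp Require Import measurable_realfun.

Set Implicit Arguments.
Unset Strict Implicit.
Unset Printing Implicit Defensive.

Import Order.TTheory GRing.Theory Num.Theory.
Import numFieldNormedType.Exports.

Local Open Scope classical_set_scope.
Local Open Scope ring_scope.

(* The law of the triple (X, A, Y) is a probability measure P on
   (T * bool) * bool, where T is the feature space; (X, A, Y) are the
   coordinates, and true stands for the label 1. *)
Section triple.
Context {d} {T : measurableType d} {R : realType}.
Variable P : probability ((T * bool) * bool)%type R.

Definition coordX (z : (T * bool) * bool) : T := z.1.1.
Definition coordA (z : (T * bool) * bool) : bool := z.1.2.
Definition coordY (z : (T * bool) * bool) : bool := z.2.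
Definition coordXA (z : (T * bool) * bool) : T * bool := z.1.

Lemma measurable_coordX : measurable_fun setT coordX.
Proof. exact: measurableT_comp. Qed.

Lemma measurable_coordA : measurable_fun setT coordA.
Proof. exact: measurableT_comp. Qed.

Lemma measurable_coordXA : measurable_fun setT coordXA.
Proof. exact: measurable_fst. Qed.

HB.instance Definition _ := isMeasurableFun.Build _ _ _ _ coordXA
  measurable_coordXA.

Definition lawXA : probability (T * bool)%type R := distribution P coordXA.

Definition groupP (a : bool) : R := fine (P (coordA @^-1` [set a])).

Lemma groupP_ge0 a : 0 <= groupP a.
Proof. exact: fine_ge0. Qed.

Lemma measurable_group a : measurable (coordA @^-1` [set a]).
Proof. by rewrite -[X in measurable X]setTI; exact: measurable_coordA. Qed.

(* The conditional law of X given A = a (the zero measure if P(A = a) = 0). *)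
Definition condX (a : bool) (B : set T) : \bar R :=
  ((groupP a)^-1%:E * P (coordX @^-1` B `&` coordA @^-1` [set a]))%E.

Section condX_measure.
Variable a : bool.

Let condX0 : condX a set0 = 0%E.
Proof. by rewrite /condX preimage_set0 set0I measure0 mule0. Qed.

Let condX_ge0 B : (0 <= condX a B)%E.
Proof. by rewrite mule_ge0// lee_fin invr_ge0 groupP_ge0. Qed.

Let condX_sigma_additive : semi_sigma_additive (condX a).
Proof.
have inv_ge0 : 0 <= (groupP a)^-1 by rewrite invr_ge0 groupP_ge0.
pose m := mrestr P (measurable_group a).
pose Xm : {mfun _ >-> T} :=
  HB.pack coordX (isMeasurableFun.Build _ _ _ _ coordX measurable_coordX).
exact: (@measure_semi_sigma_additive _ _ _
  (mscale (NngNum inv_ge0) (pushforward m Xm))).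
Qed.

HB.instance Definition _ := isMeasure.Build _ _ _ (condX a)
  condX0 condX_ge0 condX_sigma_additive.

End condX_measure.

(* eta (x, a) is a version of P(Y = 1 | A = a, X = x). *)
Definition is_cond_proba (eta : T * bool -> R) : Prop :=
  lawXA.-integrable setT (EFin \o eta) /\
  forall C : set (T * bool), measurable C ->
    P (coordXA @^-1` C `&` coordY @^-1` [set true]) =
    (\int[lawXA]_(z in C) (eta z)%:E)%E.

End triple.

(* The law of the random variable h under mu has a density with respect to the
   Lebesgue measure. *)
Definition has_density {d} {T : measurableType d} {R : realType}
    (mu : set T -> \bar R) (h : T -> R) : Prop :=
  exists g : R -> R, [/\ measurable_fun setT g, (forall y, 0 <= g y) &
    forall B : set R, measurable B ->
      mu (h @^-1` B) = (\int[lebesgue_measure]_(y in B) (g y)%:E)%E].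

Record classifier {d} (T : measurableType d) (R : realType) := Classifier {
  classify :> T * bool -> R;
  measurable_classify : measurable_fun setT classify;
  classify_itv : forall z, 0 <= classify z <= 1 }.

Section prediction.
Context {d} {T : measurableType d} {R : realType}.
Variable P : probability ((T * bool) * bool)%type R.
Variable f : classifier T R.

(* The joint law of ((X, A), Y) and the prediction: given (X, A, Y), the
   prediction is Bernoulli with parameter f (X, A), hence conditionally
   independent of Y given (X, A). *)
Definition pred_law (E : set (((T * bool) * bool) * bool)) : \bar R :=
  (\int[P]_z bernoulli_prob (f (coordXA z)) (xsection E z))%E.

Let mf : measurable_fun setT
  (fun z : (T * bool) * bool =>
     bernoulli_prob (f (coordXA z)) : pprobability bool R).
Proof.
apply: (measurableT_comp measurable_bernoulli_prob).
exact: (measurableT_comp (measurable_classify f) measurable_coordXA).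
Qed.

Lemma measurable_pred_section E : measurable E ->
  measurable_fun setT
    ((fun z => bernoulli_prob (f (coordXA z)) (xsection E z))
      : (T * bool) * bool -> \bar R).
Proof.
move=> mE.
by apply: (measurable_fun_xsection_finite_kernel (kprobability mf)); rewrite inE.
Qed.

Let pred_law0 : pred_law set0 = 0%E.
Proof.
rewrite /pred_law; under eq_integral do rewrite xsection0 measure0.
by rewrite integral0.
Qed.

Let pred_law_ge0 E : (0 <= pred_law E)%E.
Proof. exact: integral_ge0. Qed.

Let pred_law_sigma_additive : semi_sigma_additive pred_law.
Proof.
move=> F mF tF mUF.
have -> : pred_law (\bigcup_n F n) = (\sum_(0 <= n <oo) pred_law (F n))%E.
  rewrite /pred_law -integral_nneseries//; last first.
    by move=> n; exact: measurable_pred_section.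
  apply: eq_integral => z _; rewrite xsection_bigcup measure_semi_bigcup//.
  exact: trivIset_xsection.
by apply: is_cvg_ereal_nneg_natsum => n _; exact: pred_law_ge0.
Qed.

HB.instance Definition _ := isMeasure.Build _ _ _ pred_law
  pred_law0 pred_law_ge0 pred_law_sigma_additive.

Let pred_law_setT : pred_law setT = 1%E.
Proof.
have xsT z : xsection [set: ((T * bool) * bool) * bool] z = setT.
  by apply/seteqP; split=> // b _; rewrite /xsection/= inE.
rewrite /pred_law; under eq_integral do rewrite xsT probability_setT.
by rewrite integral_cst// mul1e; exact: (probability_setT P).
Qed.

HB.instance Definition _ := Measure_isProbability.Build _ _ _ pred_law
  pred_law_setT.

Definition risk (c : R) : R :=
  c * fine (pred_law [set u | u.2 = true /\ coordY u.1 = false]) +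
  (1 - c) * fine (pred_law [set u | u.2 = false /\ coordY u.1 = true]).

End prediction.

Section disparity.
Context {d} {T : measurableType d} {R : realType}.
Variable P : probability ((T * bool) * bool)%type R.

(* The equality is in \bar R, so it makes w integrable: with f = 1, both the
   positive and the negative part of w have a finite integral. *)
Definition linear_disparity (Dis : classifier T R -> R) (w : T * bool -> R) :=
  [/\ forall f, -1 <= Dis f <= 1,
      measurable_fun setT w &
      forall f, (Dis f)%:E = (\int[lawXA P]_z (f z * w z)%:E)%E].

Definition fair_bayes_optimal (c : R) (Dis : classifier T R -> R) (delta : R)
    (f : classifier T R) : Prop :=
  `|Dis f| <= delta /\
  forall g : classifier T R, `|Dis g| <= delta -> risk P f c <= risk P g c.

Definition threshold_rule (c : R) (eta w : T * bool -> R) (t : R)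
    (z : T * bool) : R :=
  (eta z > c + t * w z)%R%:R.

Definition threshold_disparity (c : R) (eta w : T * bool -> R) (t : R) : R :=
  \sum_(a : bool) groupP P a *
    \int[condX P a]_x (w (x, a) * threshold_rule c eta w t (x, a)).

(* The set of minimisers of |t| subject to |D(t)| <= delta. *)
Definition argmin_threshold (c : R) (eta w : T * bool -> R) (delta : R) :
    set R :=
  [set t | `|threshold_disparity c eta w t| <= delta /\
     forall s, `|threshold_disparity c eta w s| <= delta -> `|t| <= `|s| ].

(* A chosen minimiser; 0 if there is none. *)
Definition opt_threshold (c : R) (eta w : T * bool -> R) (delta : R) : R :=
  xget 0 (argmin_threshold c eta w delta).

End disparity.

(* Main.v *)
Require Import Defs.
From HB Require Import structures.
From mathcomp Require Import all_boot all_order all_algebra.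
From mathcomp Require Import all_classical all_reals all_analysis.
From mathcomp Require Import measurable_realfun.
From mathcomp Require Import lra.

Import Order.TTheory GRing.Theory Num.Theory.
Import numFieldNormedType.Exports.

Local Open Scope classical_set_scope.
Local Open Scope ring_scope.

(* For any t, the rule f_t = I(eta > c + t w) minimises pointwise the integrand
   of the Lagrangian R_c(f) + t Dis(f) = \int f (c + t w - eta) + const.
   Hence f_t is delta-fair optimal as soon as |Dis(f_t)| <= delta, with
   Dis(f_t) = delta if t > 0 and Dis(f_t) = - delta if t < 0.  The function
   D(t) = Dis(f_t) is nonincreasing, is continuous because the boundary sets are
   null, and its limits at +oo and -oo are respectively nonpositive and
   nonnegative; so the minimiser of |t| under |D(t)| <= delta exists, is unique,
   and, when nonzero, lies on the boundary of the constraint. *)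

(** * Smallest thresholds for continuous nonincreasing functions of a real variable *)

(** Monotonicity and [y < D 0] force every point of the sublevel set [D <= y] to be positive. Cut
    off at a known member [t1], this set is compact, hence has a least element, where continuity
    turns the inequality into an equality. *)
Lemma first_crossing (R : realType) (D : R -> R) (y : R) :
  continuous D -> {homo D : s t /~ s <= t} -> y < D 0 ->
  (exists t, D t <= y) ->
  exists t, [/\ 0 < t, D t = y & forall s, D s <= y -> t <= s].
Proof.
move=> cD dD yD0 [t1 Dt1].
have pos s : D s <= y -> 0 < s.
  move=> Dsy; rewrite ltNge; apply/negP => s0.
  by have := le_lt_trans (le_trans (dD _ _ s0) Dsy) yD0; rewrite ltxx.
pose A := `[0, t1] `&` D @^-1` [set x | x <= y].
have A0 : A !=set0 by exists t1; split => //=; rewrite in_itv/= lexx ltW ?pos.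
have cA : compact A.
  apply: compact_closedI; first exact: segment_compact.
  by apply: preimage_closed => [? _|]; [exact: cD|exact: closed_le].
have [t + tmin] : exists2 t, t \in A & forall s, s \in A -> t <= s.
  by apply: (@compact_EVT_min _ _ idfun) => //;
    apply: continuous_subspaceT => x; exact: cvg_id.
rewrite inE => -[/= t01 Dty].
(* Points beyond [t1] cannot beat [t], which is at most [t1], so the minimum over the truncated set
   is global. *)
have tle s : D s <= y -> t <= s.
  move=> Dsy; have [st1|t1s] := leP s t1.
    by apply: tmin; rewrite inE; split; rewrite //= in_itv/= st1 ltW ?pos.
  by move: t01; rewrite in_itv/= => /andP[_ tt1]; rewrite (le_trans tt1)// ltW.
exists t; split => //; first exact: pos.
(* The level [y] is attained at some [s] in [[0, t]]; minimality of [t] gives [s = t]. *)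
have [|||s] := @IVT R D 0 t y.
- by rewrite ltW ?pos.
- exact: continuous_subspaceT.
- by rewrite ge_min Dty orbT le_max ltW.
rewrite in_itv/= => /andP[_ st] Ds.
by have -> : t = s by apply/eqP; rewrite eq_le st andbT tle ?Ds.
Qed.

(** Either 0 is feasible and wins, or [D 0] lies above [y] and the first crossing of level [y] wins,
    or [D 0] lies below [- y] and a reflection reduces to the previous case. *)
Lemma argmin_normr_nonincreasing (R : realType) (D : R -> R) (y : R) :
  0 < y -> continuous D -> {homo D : s t /~ s <= t} ->
  (exists t, D t <= y) -> (exists t, - y <= D t) ->
  exists t0, [/\
    [set t | `|D t| <= y /\ forall s, `|D s| <= y -> `|t| <= `|s| ] = [set t0],
    0 < t0 -> D t0 = y & t0 < 0 -> D t0 = - y].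
Proof.
move=> y0 cD dD Dle Dge.
have [D0|] := leP `|D 0| y.
  exists 0; split; rewrite ?ltxx//; apply/seteqP; split => t /=.
    by move=> [_ /(_ _ D0)]; rewrite normr0 normr_le0 => /eqP.
  by move=> ->; split => // s _; rewrite normr0.
rewrite ltr_normr => /orP[yD0|yD0].
  have [t [t0 Dt tmin]] := @first_crossing _ D y cD dD yD0 Dle.
  exists t; split => //; last by move=> /(lt_trans t0); rewrite ltxx.
  apply/seteqP; split => s /=.
    move=> [Ds /(_ t)].
    rewrite Dt (gtr0_norm y0) (gtr0_norm t0) => /(_ (lexx _)) st.
    apply/eqP; rewrite eq_le (le_trans (ler_norm _) st)/=.
    by apply: tmin; rewrite (le_trans (ler_norm _)).
  move=> ->; split; first by rewrite Dt gtr0_norm.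
  move=> u Du; rewrite (gtr0_norm t0) (le_trans _ (ler_norm _))// tmin//.
  by rewrite (le_trans (ler_norm _)).
(* The map [t |-> - D (- t)] is again continuous and nonincreasing, and exceeds [y] at 0. *)
have [] := @first_crossing _ (fun t => - D (- t)) y.
- by move=> x; apply: continuousN; apply: continuous_comp;
    [exact: opp_continuous|exact: cD].
- by move=> s t st /=; rewrite lerN2 dD// lerN2.
- by rewrite oppr0.
- by have [t Dt] := Dge; exists (- t); rewrite opprK lerNl.
move=> t [t0 Dt tmin]; have {}Dt : D (- t) = - y by rewrite -Dt opprK.
have tle s : - y <= D s -> s <= - t.
  by move=> ?; rewrite lerNr tmin// opprK lerNl.
exists (- t); split => //; last first.
  by rewrite oppr_gt0 => /(lt_trans t0); rewrite ltxx.
apply/seteqP; split => s /=.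
  move=> [+ /(_ (- t))].
  rewrite Dt !normrN (gtr0_norm y0) (gtr0_norm t0) => + /(_ (lexx _)).
  rewrite !ler_norml => /andP[Ds _] /andP[ts _].
  by apply/eqP; rewrite eq_le ts tle.
move=> ->; split; first by rewrite Dt normrN gtr0_norm.
move=> u; rewrite ler_norml => /andP[Du _]; rewrite normrN (gtr0_norm t0).
by rewrite ler_normr lerNr tle// orbT.
Qed.

(** * Integrability of functions bounded by 1 and of their products with integrable ones *)

Lemma integrable_bounded1 d (S : measurableType d) (R : realType)
    (mu : {finite_measure set S -> \bar R}) (f : S -> R) :
  measurable_fun setT f -> (forall z, `|f z| <= 1) ->
  mu.-integrable setT (EFin \o f).
Proof.
move=> mf f1; apply: measurable_bounded_integrable => //.
  by rewrite ltey_eq fin_num_measure.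
by exists 1; split => // M M1 z _; exact: le_trans (f1 z) (ltW M1).
Qed.

Lemma integrable_bounded1M d (S : measurableType d) (R : realType)
    (mu : {measure set S -> \bar R}) (f g : S -> R) :
  measurable_fun setT f -> (forall z, `|f z| <= 1) ->
  mu.-integrable setT (EFin \o g) ->
  mu.-integrable setT (fun z => (f z * g z)%:E).
Proof.
move=> mf f1 ig; apply: (le_integrable _ _ _ ig) => //.
  apply/measurable_EFinP/measurable_funM => //.
  exact/measurable_EFinP/(measurable_int mu ig).
by move=> z _ /=; rewrite lee_fin normrM ler_piMl.
Qed.

(** * Threshold rules and their disparity as a function of the threshold *)

Section threshold_rule.
Context d (T : measurableType d) (R : realType).
Variables (c : R) (eta w : T * bool -> R).
Hypotheses (meta : measurable_fun setT eta) (mw : measurable_fun setT w).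

Lemma measurable_threshold_rule t :
  measurable_fun setT (threshold_rule c eta w t).
Proof.
rewrite (_ : threshold_rule c eta w t =
  fun z => if c + t * w z < eta z then 1 else 0); last first.
  by apply/funext => z; rewrite /threshold_rule; case: ifP.
apply: measurable_fun_ifT => //; apply: measurable_fun_ltr => //.
by apply: measurable_funD => //; exact: measurable_funM.
Qed.

Lemma measurable_boundary t : measurable [set z | eta z = c + t * w z].
Proof.
rewrite (_ : mkset _ = setT `&` [set z | eta z == c + t * w z]).
  apply: measurable_fun_eqr => //.
  by apply: measurable_funD => //; exact: measurable_funM.
by rewrite setTI; apply/seteqP; split => z /eqP.
Qed.

Lemma threshold_rule_itv t z : 0 <= threshold_rule c eta w t z <= 1.
Proof. by rewrite /threshold_rule; case: ltP => _; rewrite ?lexx ler01. Qed.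

Lemma normr_threshold_rule t z : `|threshold_rule c eta w t z| <= 1.
Proof. by have /andP[? ?] := threshold_rule_itv t z; rewrite ger0_norm. Qed.

Definition threshold_classifier t : classifier T R :=
  Classifier (measurable_threshold_rule t) (threshold_rule_itv t).

(** Among weights in [[0, 1]], weight 1 is best against a negative coefficient and weight 0 against
    a nonnegative one; the rule chooses exactly so. *)
Lemma threshold_rule_min t (g : classifier T R) z :
  threshold_rule c eta w t z * (c + t * w z - eta z) <=
  g z * (c + t * w z - eta z).
Proof.
have /andP[g0 g1] := classify_itv g z; rewrite /threshold_rule.
have [h|h] := ltP; first by rewrite ler_wnM2r ?subr_le0// ltW.
by rewrite ler_wpM2r ?subr_ge0.
Qed.

(** Off the boundary the comparison is strict, and a strict inequality between continuous functions
    of [t] persists nearby. *)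
Lemma threshold_rule_near t0 z : eta z != c + t0 * w z ->
  \forall t \near t0,
    threshold_rule c eta w t z = threshold_rule c eta w t0 z.
Proof.
move=> ne; have ct : (fun t => c + t * w z) @ t0 --> c + t0 * w z.
  by apply: cvgD; [exact: cvg_cst|apply: cvgM; [exact: cvg_id|exact: cvg_cst]].
rewrite /threshold_rule; have [lt|] := ltP (c + t0 * w z) (eta z).
  by near=> t; have -> // : c + t * w z < eta z; near: t; exact: (cvgr_lt _ ct).
rewrite le_eqVlt (negPf ne)/= => gt.
near=> t; suff /ltW : eta z < c + t * w z by rewrite ltNge => ->.
by near: t; exact: (cvgr_gt _ ct).
Unshelve. all: by end_near. Qed.

(** The rule vanishes once [n] reaches [(eta z - c) / w z]. Integer thresholds suit dominated
    convergence along a sequence. *)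
Lemma threshold_rule_pos_cvg z : 0 < w z ->
  \forall n \near \oo, threshold_rule c eta w n%:R z = 0.
Proof.
move=> wz; near=> n; rewrite /threshold_rule.
suff : eta z <= c + n%:R * w z by rewrite leNgt => /negPf ->.
rewrite -lerBlDl -ler_pdivrMr//; near: n.
exact: nbhs_infty_ger.
Unshelve. all: by end_near. Qed.

Section integral.
Variable mu : {measure set (T * bool) -> \bar R}.
Hypothesis iw : mu.-integrable setT (EFin \o w).

Let D t := \int[mu]_z (threshold_rule c eta w t z * w z).

Lemma integrable_threshold_ruleM t :
  mu.-integrable setT (fun z => (threshold_rule c eta w t z * w z)%:E).
Proof.
apply: integrable_bounded1M iw; first exact: measurable_threshold_rule.
exact: normr_threshold_rule.
Qed.

(** Raising [t] can only drop points with [w > 0] and only add points with [w < 0]; both changes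
    lower the integrand. *)
Lemma threshold_integral_nonincreasing : {homo D : s t /~ s <= t}.
Proof.
move=> t s st; apply: le_Rintegral => //; try exact: integrable_threshold_ruleM.
move=> z _; rewrite /threshold_rule.
have [w0|w0] := leP 0 (w z).
  have := ler_wpM2r w0 st.
  by case: ltP => h1; case: ltP => h2; rewrite ?mul1r ?mul0r//; lra.
have := ler_wnM2r (ltW w0) st.
by case: ltP => h1; case: ltP => h2; rewrite ?mul1r ?mul0r ?(ltW w0)//; lra.
Qed.

(** Sequential continuity by dominated convergence, with dominating function [|w|]. *)
Lemma threshold_integral_continuous :
  (forall t, mu [set z | eta z = c + t * w z] = 0%E) -> continuous D.
Proof.
move=> nul t; apply/(@cvg_nbhsP _ R^o) => u ut.
apply: fine_cvg; rewrite fineK; last first.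
  exact: integrable_fin_num (integrable_threshold_ruleM t).
have [] // := @dominated_convergence _ _ _ mu setT measurableT
  (fun n z => (threshold_rule c eta w (u n) z * w z)%:E)
  (fun z => (threshold_rule c eta w t z * w z)%:E)
  (fun z => `|(w z)%:E|%E).
- by move=> n; exact: measurable_int (integrable_threshold_ruleM _).
- exact: measurable_int (integrable_threshold_ruleM _).
(* Only the boundary at the limit [t] is exceptional: elsewhere the sequence of rules is eventually
   constant. *)
- exists [set z | eta z = c + t * w z]; split => //.
    exact: measurable_boundary.
  move=> z /=; apply: contra_notP => /eqP ne _.
  have ue : \forall n \near \oo,
      threshold_rule c eta w (u n) z = threshold_rule c eta w t z.
    exact: ut _ (threshold_rule_near _ _ ne).
  by apply: cvg_near_cst; apply: filterS ue => n ->.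
- exact: integrable_abse.
- apply: aeW => z n _; rewrite lee_fin normrM.
  by rewrite ler_piMl// normr_threshold_rule.
Qed.

Lemma threshold_integral_le y : 0 < y -> exists t, D t <= y.
Proof.
(* The positive part of w dominates w, and its threshold integral vanishes at
   +oo. *)
move=> y0.
pose F n z := (threshold_rule c eta w n%:R z * Num.max (w z) 0)%:E.
have mwp : measurable_fun setT (fun z => Num.max (w z) 0).
  exact: measurable_maxr.
have mF n : measurable_fun setT (F n).
  apply/measurable_EFinP/measurable_funM => //.
  exact: measurable_threshold_rule.
have Fw n z : (`|F n z| <= `|(w z)%:E|)%E.
  rewrite lee_fin normrM.
  rewrite (le_trans (ler_piMl (normr_ge0 _) (normr_threshold_rule _ _)))//.
  by have [w0|w0] := leP (w z) 0; rewrite ?normr0.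
have iF n : mu.-integrable setT (F n).
  by apply: (le_integrable _ _ _ iw).
have [] // := @dominated_convergence _ _ _ mu setT measurableT F (cst 0%E)
  (fun z => `|(w z)%:E|%E).
- apply: aeW => z _; apply: cvg_near_cst; rewrite /F.
  have [w0|w0] := leP (w z) 0; first by apply: nearW => n; rewrite mulr0.
  have := threshold_rule_pos_cvg _ w0.
  by apply: filterS => n ->; rewrite mul0r.
- exact: integrable_abse.
- by apply: aeW => z n _.
move=> _ _; rewrite integral0 => /fine_cvg /cvgr_le /(_ _ y0)[n _ /(_ n)].
rewrite /= leqnn => /(_ isT) Fny; exists n%:R; apply: le_trans Fny.
apply: le_Rintegral => //; [exact: integrable_threshold_ruleM|exact: iF|].
move=> z _; have /andP[? _] := threshold_rule_itv n%:R z.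
by rewrite ler_wpM2l// le_max lexx.
Qed.

End integral.
End threshold_rule.

(* Replacing w by - w turns D(t) into - D(- t). *)
Lemma threshold_integral_ge d (T : measurableType d) (R : realType)
    (mu : {measure set (T * bool) -> \bar R}) (c : R) (eta w : T * bool -> R)
    (y : R) :
  measurable_fun setT eta -> measurable_fun setT w ->
  mu.-integrable setT (EFin \o w) -> 0 < y ->
  exists t, - y <= \int[mu]_z (threshold_rule c eta w t z * w z).
Proof.
move=> meta mw iw y0.
have iwN : mu.-integrable setT (EFin \o (fun z => - w z)).
  exact: (integrableN iw).
have mwN : measurable_fun setT (fun z => - w z) by exact: measurableT_comp.
have [t Dt] := @threshold_integral_le _ _ _ c _ _ meta mwN _ iwN _ y0.
exists (- t); rewrite lerNl; apply: le_trans Dt.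
have -> : threshold_rule c eta w (- t) =
    threshold_rule c eta (fun z => - w z) t.
  by apply/funext => z; rewrite /threshold_rule mulrN mulNr.
rewrite -mulN1r -RintegralZl//; last first.
  apply: integrable_bounded1M => //; last exact: normr_threshold_rule.
  exact: measurable_threshold_rule.
rewrite le_eqVlt; apply/orP; left; apply/eqP; apply: eq_Rintegral => z _.
by rewrite mulN1r mulrN.
Qed.

(** * Integration against a restricted measure, then against the law of (X, A) split by group *)

(** The complement of [D] is null for the restricted measure, and the two measures agree on subsets
    of [D]. *)
Lemma ge0_integral_mrestr d (S : measurableType d) (R : realType)
    (mu : {measure set S -> \bar R}) (D : set S) (mD : measurable D)
    (f : S -> \bar R) :
  measurable_fun setT f -> (forall z, 0 <= f z)%E ->
  (\int[mrestr mu mD]_z f z = \int[mu]_(z in D) f z)%E.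
Proof.
move=> mf f0.
rewrite [LHS](@ge0_negligible_integral _ _ _ _ _ (~` D))//; last 2 first.
- exact: measurableC.
- by rewrite /= /mrestr setIC setICr measure0.
rewrite setDE setTI setCK; apply: eq_measure_integral => A mA AD.
by rewrite /= /mrestr setIidl.
Qed.

Section lawXA.
Context d (T : measurableType d) (R : realType).
Variable P : probability ((T * bool) * bool)%type R.

Let pairA (a : bool) (x : T) : T * bool := (x, a).

Let mpairA a : measurable_fun setT (pairA a).
Proof. exact: pair2_measurable. Qed.

Hypothesis hp : forall a, 0 < groupP P a.

(** Law of total probability: each positive [groupP] cancels the normalisation in [condX], leaving
    two disjoint slices of [B]. *)
Lemma lawXA_sum (B : set (T * bool)) : measurable B ->
  (lawXA P B = (groupP P true)%:E * condX P true (pairA true @^-1` B) +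
    (groupP P false)%:E * condX P false (pairA false @^-1` B))%E.
Proof.
move=> mB; rewrite /condX !muleA -!EFinM !divff ?gt_eqF// !mul1e.
have mX a : measurable
    (coordX @^-1` (pairA a @^-1` B) `&` @coordA _ T @^-1` [set a]).
  apply: measurableI; last exact: measurable_group.
  rewrite -[X in measurable X]setTI; apply: measurable_coordX => //.
  by rewrite -[X in measurable X]setTI; exact: mpairA.
rewrite -measureU//; last first.
  by apply/seteqP; split => // -[[x a] y] [[_ /= ->] [_]].
congr (P _); apply/seteqP; split => -[[x [|]] y] /=;
  by rewrite /coordXA/coordX/coordA/pairA/=; by [left|right|case=> -[]].
Qed.

(** The share of group [a] in the law of (X, A), as a measure on pairs; the law is the sum of the
    two shares. *)
Let component a :=
  pushforward (mscale (NngNum (ltW (hp a))) (condX P a)) (pairA a).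

Lemma ge0_integral_lawXA (h : T * bool -> \bar R) :
  measurable_fun setT h -> (forall z, 0 <= h z)%E ->
  (\int[lawXA P]_z h z =
   (groupP P true)%:E * \int[condX P true]_x h (x, true) +
   (groupP P false)%:E * \int[condX P false]_x h (x, false))%E.
Proof.
move=> mh h0.
rewrite (eq_measure_integral (measure_add [the measure _ _ of component true]
    [the measure _ _ of component false])); last first.
  move=> B mB _.
  by apply: etrans (lawXA_sum _ mB) _; apply/esym; apply: measure_addE.
rewrite ge0_integral_measure_add//.
congr (_ + _)%E;
  rewrite ge0_integral_pushforward// preimage_setT ge0_integral_mscale//.
all: by [exact: (measurableT_comp mh (mpairA _))|move=> x _; exact: h0].
Qed.

(** By contraposition: an infinite integral of [|h|] over one group, multiplied by its positive
    weight, would make the whole integral infinite. *)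
Lemma integrable_condX (h : T * bool -> \bar R) a :
  (lawXA P).-integrable setT h ->
  (condX P a).-integrable setT (fun x => h (x, a)).
Proof.
move=> /integrableP[mh hoo]; apply/integrableP; split.
  exact: (measurableT_comp mh (mpairA a)).
have pfin b : (0 <= \int[condX P b]_x `|h (x, b)|)%E by exact: integral_ge0.
move: hoo; rewrite ge0_integral_lawXA//; last exact: measurableT_comp.
apply: contraTT; rewrite -!leNgt !leye_eq => /eqP hoo.
by case: a hoo => hoo; rewrite hoo gt0_muley ?lte_fin ?hp//;
  rewrite ?addye ?addey//;
  rewrite -ltNye (lt_le_trans (ltNyr 0))// mule_ge0// lee_fin ltW.
Qed.

(** The nonnegative case applies to the positive and negative parts; their group integrals are
    finite, so the identity passes to real numbers. *)
Lemma Rintegral_lawXA (h : T * bool -> R) :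
  (lawXA P).-integrable setT (EFin \o h) ->
  \int[lawXA P]_z h z =
  \sum_(a : bool) groupP P a * \int[condX P a]_x h (x, a).
Proof.
move=> ih; rewrite big_bool /Rintegral.
have mh := measurable_int _ ih.
rewrite integralE [in RHS]integralE [X in _ = _ + _ * fine X]integralE.
have ipos := integrable_funepos measurableT ih.
have ineg := integrable_funeneg measurableT ih.
have fp a := integrable_fin_num measurableT (integrable_condX _ a ipos).
have fn a := integrable_fin_num measurableT (integrable_condX _ a ineg).
have Ep a : ((fun x => (h (x, a))%:E)^\+ = fun x => (EFin \o h)^\+ (x, a))%E.
  by apply/funext => x; rewrite ?funeposE ?funenegE.
have En a : ((fun x => (h (x, a))%:E)^\- = fun x => (EFin \o h)^\- (x, a))%E.
  by apply/funext => x; rewrite ?funeposE ?funenegE.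
rewrite !ge0_integral_lawXA//; last 2 first.
- exact: measurable_funeneg.
- exact: measurable_funepos.
rewrite !Ep !En.
rewrite -(fineK (fp true)) -(fineK (fp false)).
rewrite -(fineK (fn true)) -(fineK (fn false)) /=.
by lra.
Qed.

End lawXA.

(** * Replacing the label by its conditional probability under the integral *)

Section label.
Context d (T : measurableType d) (R : realType).
Variable P : probability ((T * bool) * bool)%type R.

Let label (z : (T * bool) * bool) : R := (coordY z)%:R.

Lemma measurable_coordY : measurable_fun setT (@coordY _ T).
Proof. exact: measurable_snd. Qed.

Lemma measurable_preimage_coordY b : measurable (@coordY _ T @^-1` [set b]).
Proof. by rewrite -[X in measurable X]setTI; exact: measurable_coordY. Qed.

Let label_indic : label = \1_(@coordY _ T @^-1` [set true]).
Proof.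
apply/funext => z; rewrite /label indicE; congr (_ *+ nat_of_bool _).
by apply/idP/idP; rewrite inE.
Qed.

Lemma measurable_label : measurable_fun setT label.
Proof.
rewrite label_indic; apply: measurable_indic.
exact: measurable_preimage_coordY.
Qed.

(* In the proof, nu C is P(Y = 1, (X, A) \in C); it has density eta, and eta
   may be negative on a null set, hence the detour through Radon-Nikodym. *)
Lemma integral_label (f : T * bool -> R) (eta : T * bool -> R) :
  is_cond_proba P eta ->
  measurable_fun setT f -> (forall z, 0 <= f z <= 1) ->
  (\int[P]_z (f (coordXA z) * label z)%:E =
   \int[lawXA P]_z (f z * eta z)%:E)%E.
Proof.
move=> [ieta etaE] mf f01.
have mY := measurable_preimage_coordY true.
have f0 z : 0 <= f z by case/andP: (f01 z).
(* The measure structure on a pushforward takes the measurability of the map as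
   an argument, so that push is a function. *)
pose push := [the {measure set (T * bool) -> \bar R} of
  pushforward (mrestr P mY) (@coordXA _ T)].
pose m := push (@measurable_coordXA _ T).
have finm : fin_num_fun m.
  move=> B mB; apply: (@fin_num_measure _ _ _ (mrestr P mY)).
  by rewrite -[X in measurable X]setTI; exact: measurable_coordXA.
pose nu : {finite_measure set (T * bool)%type -> \bar R} :=
  HB.pack (Measure.sort m) (Measure_isFinite.Build _ _ _ (Measure.sort m) finm).
have nuE B : measurable B -> nu B = (\int[lawXA P]_(z in B) (eta z)%:E)%E.
  by move=> mB; rewrite -etaE.
have nulaw : nu `<< lawXA P.
  apply/null_content_dominatesP => B mB lawB0; rewrite nuE//.
  apply: null_set_integral => //.
  exact: measurable_funTS (measurable_int _ ieta).
have fnu : nu.-integrable setT (EFin \o f).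
  by apply: integrable_bounded1 => // z; case/andP: (f01 z); rewrite ger0_norm.
have mfXA : measurable_fun setT (fun z => (f (@coordXA _ T z))%:E).
  apply/measurable_EFinP.
  exact: (measurableT_comp mf (@measurable_coordXA _ T)).
(* Integrating against [nu] amounts to integrating over the event Y = 1, which is what the factor
   [label] encodes. *)
transitivity (\int[nu]_z (f z)%:E)%E.
  apply/esym; apply: etrans (ge0_integral_pushforward _ _ _ _ _) _ => //.
  - exact/measurable_EFinP.
  - by move=> z _; rewrite lee_fin.
  rewrite preimage_setT ge0_integral_mrestr//; last first.
    by move=> z; rewrite lee_fin.
  rewrite integral_mkcond; apply: eq_integral => z _.
  rewrite patchE label_indic indicE.
  by case: ifP => _; rewrite ?mulr1 ?mulr0.
apply: etrans
  (esym (Radon_Nikodym_change_of_variables nulaw measurableT fnu)) _.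
have mRN := measurable_int _ (@Radon_Nikodym_integrable _ _ _
  (charge_of_finite_measure nu) (lawXA P) nulaw).
apply: ae_eq_integral => //.
- by apply: emeasurable_funM => //; exact/measurable_EFinP.
- apply/measurable_EFinP/measurable_funM => //.
  by apply/measurable_EFinP; exact: measurable_int ieta.
(* [eta] and the Radon-Nikodym derivative have the same integral over every measurable set, hence
   agree almost everywhere. *)
have etaRN : ae_eq (lawXA P) setT (EFin \o eta)
    (Radon_Nikodym (charge_of_finite_measure nu) (lawXA P)).
  apply: integral_ae_eq => // B _ mB.
  by rewrite -Radon_Nikodym_integral//= -nuE.
exact: ae_eq_sym (ae_eqe_mul2l (EFin \o f) etaRN).
Qed.

End label.

(** * The cost-sensitive risk as an affine functional of the classifier *)

Section risk.
Context d (T : measurableType d) (R : realType).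
Variable P : probability ((T * bool) * bool)%type R.

(** The section of the event at [z] is [[set b]] if the label of [z] is [y] and empty otherwise, so
    its Bernoulli mass is explicit. *)
Lemma pred_lawE (f : classifier T R) (b y : bool) :
  pred_law P f [set u | u.2 = b /\ coordY u.1 = y] =
  (\int[P]_z ((if b then f (coordXA z) else 1 - f (coordXA z)) *
              (coordY z == y)%:R)%:E)%E.
Proof.
apply: eq_integral => z _; rewrite bernoulli_probE ?classify_itv// !diracE.
have memE v : (v \in xsection [set u : ((T * bool) * bool) * bool |
    u.2 = b /\ coordY u.1 = y] z) = (v == b) && (coordY z == y).
  rewrite mem_xsection; apply/idP/idP; rewrite inE/=.
    by move=> [-> ->]; rewrite !eqxx.
  by move=> /andP[/eqP -> /eqP].
rewrite !memE -!EFinM -EFinD; congr EFin.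
by case: b {memE}; rewrite /= ?mulr1 ?mulr0 ?addr0 ?add0r.
Qed.

(** The product of prediction and label gets coefficient [- c - (1 - c) = - 1]. The last term does
    not depend on [f] and cancels when two classifiers are compared. *)
Lemma riskE (eta : T * bool -> R) (f : classifier T R) (c : R) :
  is_cond_proba P eta ->
  risk P f c = c * \int[lawXA P]_z f z - \int[lawXA P]_z (f z * eta z) +
    (1 - c) * \int[P]_z (coordY z)%:R.
Proof.
move=> heta.
have mf := measurable_classify f.
have mfXA : measurable_fun setT (fun z => f (@coordXA _ T z)).
  exact: (measurableT_comp mf (@measurable_coordXA _ T)).
have f1 z : `|f z| <= 1.
  by have /andP[f0 f1] := classify_itv f z; rewrite ger0_norm.
have y1 (z : (T * bool) * bool) : `|(coordY z)%:R| <= 1 :> R.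
  by case: coordY; rewrite ?normr1 ?normr0.
have my := @measurable_label _ T R.
have if_ : P.-integrable setT (fun z => (f (coordXA z))%:E).
  by apply: integrable_bounded1 => // z; exact: f1.
have iy : P.-integrable setT (fun z => (coordY z)%:R%:E).
  exact: integrable_bounded1.
have ify : P.-integrable setT (fun z => (f (coordXA z) * (coordY z)%:R)%:E).
  by apply: integrable_bounded1M => // z; exact: f1.
have fetaE : \int[lawXA P]_z (f z * eta z) =
    \int[P]_z (f (coordXA z) * (coordY z)%:R).
  congr fine; apply/esym; apply: integral_label => // z.
  exact: classify_itv.
have fE : \int[lawXA P]_z f z = \int[P]_z (f (coordXA z)).
  by congr fine; apply: integral_distribution => //; exact/measurable_EFinP.
have -> : risk P f c =
    c * \int[P]_z (f (coordXA z) * (coordY z == false)%:R) +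
    (1 - c) * \int[P]_z ((1 - f (coordXA z)) * (coordY z == true)%:R).
  by rewrite /risk !pred_lawE.
have -> : \int[P]_z (f (coordXA z) * (coordY z == false)%:R) =
    \int[lawXA P]_z f z - \int[lawXA P]_z (f z * eta z).
  rewrite fE fetaE -RintegralB//; apply: eq_Rintegral => z _.
  by case: coordY; rewrite ?mulr1 ?mulr0 ?subr0 ?subrr.
have -> : \int[P]_z ((1 - f (coordXA z)) * (coordY z == true)%:R) =
    \int[P]_z (coordY z)%:R - \int[lawXA P]_z (f z * eta z).
  rewrite fetaE -RintegralB//; apply: eq_Rintegral => z _.
  by case: coordY; rewrite ?mulr1 ?mulr0 ?subr0.
by lra.
Qed.

End risk.

(** * Optimality through the Lagrangian *)

Theorem corollary4p11 (d : measure_display) (T : measurableType d)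
    (R : realType) (P : probability ((T * bool) * bool)%type R)
    (eta w : T * bool -> R) (Dis : classifier T R -> R) (c delta : R)
    (hp : forall a : bool, 0 < groupP P a)
    (heta : is_cond_proba P eta)
    (hc : 0 <= c <= 1)
    (hDis : linear_disparity P Dis w)
    (heta_density : forall a : bool,
       has_density (condX P a) (fun x => eta (x, a)))
    (hw_density : forall a : bool,
       has_density (condX P a) (fun x => w (x, a)))
    (hboundary : forall (a : bool) (t : R),
       condX P a [set x | eta (x, a) = c + t * w (x, a)] = 0%E)
    (hdelta : 0 < delta) :
  argmin_threshold P c eta w delta = [set opt_threshold P c eta w delta] /\
  exists fstar : classifier T R,
    fair_bayes_optimal P c Dis delta fstar /\
    forall (x : T) (a : bool),
      fstar (x, a) =
      (eta (x, a) > c + opt_threshold P c eta w delta * w (x, a))%R%:R.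
Proof.
have [_ mw DisE] := hDis; have [ieta _] := heta.
have meta : measurable_fun setT eta.
  by apply/measurable_EFinP; exact: measurable_int ieta.
(* For the constant classifier 1 the disparity is the integral of [w]; being finite, it makes the
   measurable [w] integrable. *)
have iw : (lawXA P).-integrable setT (EFin \o w).
  have cst1_itv (z : T * bool) : 0 <= (cst 1 : T * bool -> R) z <= 1.
    by rewrite /= ler01 lexx.
  have mcst1 : measurable_fun setT (cst 1 : T * bool -> R).
    exact: measurable_cst.
  pose one := Classifier mcst1 cst1_itv.
  apply/integrableP; split; first exact/measurable_EFinP.
  rewrite integral_fin_num_abs//.
  rewrite (_ : (\int[_]_z _)%E = (Dis one)%:E)// DisE.
  by apply: eq_integral => z _; rewrite /= mul1r.
have ig (g : classifier T R) (h : T * bool -> R) :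
    (lawXA P).-integrable setT (EFin \o h) ->
    (lawXA P).-integrable setT (fun z => (g z * h z)%:E).
  apply: integrable_bounded1M => [|z]; first exact: measurable_classify.
  by have /andP[? ?] := classify_itv g z; rewrite ger0_norm.
have DisR g : Dis g = \int[lawXA P]_z (g z * w z).
  by rewrite /Rintegral -DisE.
have mu0 t : lawXA P [set z | eta z = c + t * w z] = 0%E.
  rewrite lawXA_sum//; last exact: measurable_boundary.
  by rewrite !hboundary !mule0 adde0.
pose D t := \int[lawXA P]_z (threshold_rule c eta w t z * w z).
(* Summing over groups, the disparity at [t] is a single integral against the law of (X, A). *)
have DE : threshold_disparity P c eta w = D.
  apply/funext => t; rewrite /D Rintegral_lawXA//; last first.
    exact: integrable_threshold_ruleM.
  apply: eq_bigr => a _; congr (_ * _); apply: eq_Rintegral => x _.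
  by rewrite mulrC.
have [||||t0 [argminE Dpos Dneg]] :=
  argmin_normr_nonincreasing R D delta hdelta.
- exact: threshold_integral_continuous.
- exact: threshold_integral_nonincreasing.
- exact: threshold_integral_le.
- exact: threshold_integral_ge.
rewrite -DE in argminE.
(* The argmin set is a singleton, so [xget] returns its element and not the default 0. *)
have optE : opt_threshold P c eta w delta = t0.
  rewrite /opt_threshold /argmin_threshold argminE.
  by apply: (@xgetPex _ 0 [set t0]); exists t0.
split; first by rewrite optE.
exists (threshold_classifier _ _ _ c _ _ meta mw t0); split; last first.
  by move=> x a; rewrite optE.
have Dt0 : `|D t0| <= delta.
  by have : [set t0] t0 by []; rewrite -argminE DE => -[].
split; first by rewrite DisR.
move=> g; rewrite DisR => gdelta; rewrite !(riskE _ _ _ _ eta)// lerD2r.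
set f := threshold_classifier _ _ _ _ _ _ _ _ _.
have iconst : (lawXA P).-integrable setT (EFin \o cst c).
  exact: finite_measure_integrable_cst.
have itw : (lawXA P).-integrable setT (EFin \o (fun z => t0 * w z)).
  exact: (integrableZl measurableT t0 iw).
have ilag : (lawXA P).-integrable setT
    (EFin \o (fun z => c + t0 * w z - eta z)).
  exact: (integrableB measurableT (integrableD measurableT iconst itw) ieta).
(* Up to the constant dropped above, this is the risk plus [t0] times the disparity. *)
have lagrange (h : classifier T R) :
    \int[lawXA P]_z (h z * (c + t0 * w z - eta z)) =
    c * \int[lawXA P]_z h z - \int[lawXA P]_z (h z * eta z) +
    t0 * \int[lawXA P]_z (h z * w z).
  have ih : (lawXA P).-integrable setT (EFin \o h).
    apply: integrable_bounded1 => [|z]; first exact: measurable_classify.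
    by have /andP[? ?] := classify_itv h z; rewrite ger0_norm.
  rewrite -RintegralZl// -RintegralB//; last 2 first.
  - exact: (integrableZl measurableT c ih).
  - exact: ig.
  rewrite -RintegralZl//; last exact: ig.
  rewrite -RintegralD//; last 2 first.
  - exact: (integrableB measurableT (integrableZl measurableT c ih)
      (ig h _ ieta)).
  - exact: (integrableZl measurableT t0 (ig h _ iw)).
  by apply: eq_Rintegral => z _; lra.
have : \int[lawXA P]_z (f z * (c + t0 * w z - eta z)) <=
       \int[lawXA P]_z (g z * (c + t0 * w z - eta z)).
  apply: le_Rintegral => //; try exact: ig.
  by move=> z _; exact: threshold_rule_min.
rewrite !lagrange.
(* Subtracting this bound from the Lagrangian inequality leaves the inequality between risks. *)
suff : t0 * \int[lawXA P]_z (g z * w z) <= t0 * D t0 by rewrite /D; lra.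
move: gdelta; rewrite ler_norml => /andP[gl gr].
(* Complementary slackness: for nonzero [t0], [D t0] is the extreme feasible value with the sign of
   [t0]; for zero both sides vanish. *)
have [t0n|t0p|->] := ltgtP t0 0; last by rewrite !mul0r.
- by rewrite (Dneg t0n) ler_wnM2l// ltW.
- by rewrite (Dpos t0p) ler_wpM2l// ltW.
Qed.
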